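(* Let $\alpha=12\cdots c$ and $\hat\alpha=c(c-1)\cdots1$. Fix an equivalence class of $S_n$ under the $S_c$-equivalence, and let $w$ be the $(\{S_c\},\{\alpha,\hat\alpha\})$-root permutation of this class. Then $w$ can be written as a concatenation $w=v_1v_2\cdots v_k$ such that (1) each $v_i$ is an increasing or decreasing word of consecutive integers, and (2) every $u\in S_n$ equivalent to $w$ is of the form $u=v'_1v'_2\cdots v'_k$, where each $v'_i$ occupies the same positions as $v_i$, consists of the same letters as $v_i$, and $v'_i\equiv v_i$ under the $S_c$-equivalence.
   Context: Fix positive integers $c\le n$. $S_m$ is the set of permutations of $\{1,\dots,m\}$ written as words. A word $w_1\cdots w_c$ (distinct integer letters) forms $u\in S_c$ if there is an integer $k$ with $w_i=u_i+k$ for all $i$. An $S_c$-hit in a word with distinct letters is a contiguous subword of length $c$ forming some $u\in S_c$; an $S_c$-rearrangement rearranges the letters of an $S_c$-hit arbitrarily in place. The $S_c$-equivalence ($\equiv$) is the reflexive-transitive closure of $S_c$-rearrangement (on $S_n$, and likewise on words with distinct letters). Tail size of a word $w$ of length $m$ with distinct letters: least $k\ge1$ such that the first $k$ letters are the $k$ smallest letters of $w$. $w$ is right leaning if its tail size is $<m$, left leaning if its reversal has tail size $<m$, omni leaning if neither. Polarization of a hit $h$ in $w\in S_n$: if $h$ is all of $w$, $h$ is left polarized. Otherwise let $a$ be the average of the letters of $h$, $w'$ be $w$ with $h$ replaced by the single letter $a$, and $b$ the letter adjacent to $a$ in $w'$ closest in value to $a$ (ties: the left one). If $a,b$ appear in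 increasing order in $w'$, $h$ is right polarized; if decreasing, left polarized. A hit is backward if it is right polarized and left leaning, or left polarized and right leaning, or omni leaning; otherwise forward. An $S_c$-hit $h$ is $(S_c,\{\alpha,\hat\alpha\})$-straightened if it forms $\alpha$ or $\hat\alpha$ and either it is forward, or it is backward and no rearrangement of $h$ makes it forward. Straightening a hit means rearranging it in place so it becomes straightened. The root permutation of a class is the unique permutation in the class that can be reached from every other permutation of the class by repeated straightenings of non-straightened $S_c$-hits (it exists and is unique). *)

(* Defs.v *)
From mathcomp Require Import all_boot all_order all_algebra.
From Stdlib Require Import Relations.Relation_Operators.

Set Implicit Arguments.
Unset Strict Implicit.
Unset Printing Implicit Defensive.

Import Order.TTheory GRing.Theory Num.Theory.

(* Words are sequences of natural numbers. The permutations of {1, ..., m} and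
   all their subwords have positive letters, so natural numbers suffice both
   for the letters and for the shifts in [forms]. *)
Definition word := seq nat.

Definition in_S (m : nat) (w : word) : bool := perm_eq w (iota 1 m).

Definition forms (w u : word) : Prop := exists k : nat, w = [seq i + k | i <- u].

Definition is_hit (c : nat) (h : word) : Prop := exists2 u, in_S c u & forms h u.

(* A hit is always considered together with its place in the word: in
   [p ++ h ++ s], the hit [h] is preceded by [p] and followed by [s]. *)
Variant rearrangement (c : nat) : word -> word -> Prop :=
  Rearrangement p h h' s of is_hit c h & perm_eq h h' :
    rearrangement c (p ++ h ++ s) (p ++ h' ++ s).

Definition S_equiv (c : nat) : word -> word -> Prop :=
  clos_refl_trans word (rearrangement c).

(* [find] is a 0-based index into [:: 1; ...; size w], hence the successor. *)
Definition tail_size (w : word) : nat :=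
  (find (fun k => perm_eq (take k w) (take k (sort leq w)))
        (iota 1 (size w))).+1.

Definition right_leaning (w : word) : bool := tail_size w < size w.
Definition left_leaning (w : word) : bool := tail_size (rev w) < size w.
Definition omni_leaning (w : word) : bool :=
  ~~ right_leaning w && ~~ left_leaning w.

Section Polarization.
Local Open Scope ring_scope.

Definition average (h : word) : rat := (sumn h)%:R / (size h)%:R.

(* The letter [b] adjacent to [a] is the last letter [x] of [p] or the first
   letter [y] of [s]; a tie is resolved in favour of [x]. *)
Definition right_polarized (p h s : word) : bool :=
  let a := average h in
  match rev p, s with
  | [::], [::] => false
  | x :: _, [::] => x%:R < a
  | [::], y :: _ => a < y%:R
  | x :: _, y :: _ =>
      if `|x%:R - a| <= `|y%:R - a| then x%:R < a else a < y%:R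
  end.

(* When [p ++ h ++ s] has distinct letters and [h] is a hit, [a] lies between
   the least and the greatest letters of [h] while [b] does not, so [a] and [b]
   differ and this is exactly the remaining case. *)
Definition left_polarized (p h s : word) : bool := ~~ right_polarized p h s.

End Polarization.

Definition backward (p h s : word) : bool :=
  [|| right_polarized p h s && left_leaning h,
      left_polarized p h s && right_leaning h
    | omni_leaning h].

Definition forward (p h s : word) : bool := ~~ backward p h s.

Definition alpha (c : nat) : word := iota 1 c.
Definition alpha_hat (c : nat) : word := rev (iota 1 c).

Definition straightened (c : nat) (p h s : word) : Prop :=
  (forms h (alpha c) \/ forms h (alpha_hat c)) /\
  (forward p h s \/
   backward p h s /\ ~ (exists2 h', perm_eq h h' & forward p h' s)).

Variant straightening (c : nat) : word -> word -> Prop :=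
  Straightening p h h' s of is_hit c h & ~ straightened c p h s
      & perm_eq h h' & straightened c p h' s :
    straightening c (p ++ h ++ s) (p ++ h' ++ s).

Definition reachable_in_class (c : nat) (x w : word) : Prop :=
  S_equiv c x w /\
  forall u, S_equiv c x u -> clos_refl_trans word (straightening c) u w.

(* [w] is the root permutation of the equivalence class of [x]. *)
Definition is_root (c : nat) (x w : word) : Prop :=
  unique (reachable_in_class c x) w.

Definition consecutive_run (v : word) : Prop :=
  exists a m : nat, v = iota a m.+1 \/ v = rev (iota a m.+1).

(* Main.v *)
(* Take for the [v_i] the maximal runs of consecutive letters of the root
   permutation [w]; for [c > 1] every hit of [w] is increasing if it is right
   polarized and decreasing if it is left polarized. As long as only the blocks
   have been rearranged, no hit can straddle two of them: it would contain a
   final part of one block, some whole blocks and an initial part of another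
   one, and these parts turn out to consist of the same letters as in [w].
   Indeed blocks shorter than [c] cannot be rearranged; longer ones keep their
   orientation; and a block of length [c] is a hit of [w], which its polarization
   orients towards the rest of the straddling hit. So the same window of [w] would
   be a hit, hence monotone, contradicting the maximality of the runs. *)
Require Import Defs.
From mathcomp Require Import all_boot all_order all_algebra.
From mathcomp Require Import zify lra.
From Stdlib Require Import Relations.Relation_Operators.
From Stdlib Require List.

Import Order.TTheory GRing.Theory Num.Theory.

Set Implicit Arguments.
Unset Strict Implicit.
Unset Printing Implicit Defensive.

(** * Monotone runs of consecutive letters, with the direction encoded as a boolean *)

Definition before (d : bool) (x y : nat) : bool := if d then x < y else y < x.

Definition run (d : bool) (a m : nat) : word :=
  if d then iota a m else rev (iota a m).

Definition adjacent (x y : nat) : bool := (x == y.+1) || (y == x.+1).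

(** Quantifying over [d] allows the two outer letters to be given in either order of value. *)
Definition convex (v : word) : Prop :=
  forall d x y z, x \in v -> y \in v -> before d x z -> before d z y -> z \in v.

Lemma word_neq0 (v : word) : (v != [::]) = (0 < size v).
Proof. by case: v. Qed.

Lemma before_negb d x y : before (~~ d) x y = before d y x.
Proof. by case: d. Qed.

Lemma before_total d x y : x != y -> before d x y || before d y x.
Proof. by case: d; rewrite /before; lia. Qed.

Lemma before_asym d x y : before d x y -> before d y x -> False.
Proof. by case: d; rewrite /before; lia. Qed.

Lemma before_trans d : transitive (before d).
Proof. by case: d => y x z; rewrite /before; lia. Qed.

Lemma before_inj d e x y : before d x y -> before e x y -> d = e.
Proof. by case: d; case: e; rewrite /before //; lia. Qed.

Lemma mem_run d a m x : (x \in run d a m) = (a <= x < a + m).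
Proof. by case: d; rewrite /run ?mem_rev mem_iota. Qed.

Lemma size_run d a m : size (run d a m) = m.
Proof. by case: d; rewrite /run ?size_rev size_iota. Qed.

Lemma rev_run d a m : rev (run d a m) = run (~~ d) a m.
Proof. by case: d; rewrite /run //= revK. Qed.

Lemma perm_run d a m : perm_eq (run d a m) (iota a m).
Proof. by case: d; rewrite /run // perm_rev. Qed.

Lemma run_sorted d a m : sorted (before d) (run d a m).
Proof.
case: d; rewrite /run /before; first exact: iota_ltn_sorted.
by rewrite rev_sorted iota_ltn_sorted.
Qed.

Lemma run_adjacent d a m : sorted adjacent (run d a m).
Proof.
have Hinc : sorted adjacent (iota a m).
  elim: m a => [|[|m] IH] a //.
  by have := IH a.+1; rewrite /= => ->; rewrite andbT /adjacent eqxx orbT.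
case: d => //; rewrite /run rev_sorted.
by apply: sub_sorted Hinc => x y; rewrite /adjacent orbC.
Qed.

(** A run of at least two letters shows its direction in its first two letters; a single letter is a
    run in both directions. *)
Lemma run_inj d e a b m : 1 < m -> run d a m = run e b m -> d = e.
Proof.
move=> m_gt1 E; have := run_sorted e b m; have := run_sorted d a m.
rewrite -E; have := size_run d a m; case: (run d a m) => [|x [|y s]] /=; try lia.
move=> _ /andP[xy _] /andP[xy' _]; exact: before_inj xy xy'.
Qed.

Lemma consecutive_runP v :
  consecutive_run v -> exists d a m, v = run d a m.+1.
Proof. by case=> a [m [->|->]]; [exists true|exists false]; exists a, m. Qed.

Lemma perm_iota_convex (v : word) a m : perm_eq v (iota a m) -> convex v.
Proof.
move=> /perm_mem E d x y z; rewrite !E !mem_iota /before.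
by case: d; lia.
Qed.

Lemma run_convex d a m : convex (run d a m).
Proof. exact: perm_iota_convex (perm_run d a m). Qed.

(** * Hits as rearranged intervals of positive letters *)

Lemma shift_iota k m : [seq i + k | i <- iota 1 m] = iota k.+1 m.
Proof. by rewrite -[k.+1]addn1 iotaDl; apply: eq_map => i; rewrite addnC. Qed.

Lemma forms_run c h d : forms h (run d 1 c) <-> exists2 a, 0 < a & h = run d a c.
Proof.
have E k : [seq i + k | i <- run d 1 c] = run d k.+1 c.
  by rewrite /run; case: d; rewrite ?map_rev shift_iota.
split; first by case=> k ->; exists k.+1.
by case=> -[//|k] _ ->; exists k.
Qed.

Lemma hitP c h : is_hit c h <-> exists2 a, 0 < a & perm_eq h (iota a c).
Proof.
split.
  case=> u; rewrite /in_S => Hu [k ->]; exists k.+1 => //.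
  by rewrite -shift_iota perm_map.
(* Subtracting [k] undoes the shift; truncation does no harm because every letter of [h] exceeds
   [k]. *)
case=> -[//|k] _ Hh; exists [seq i - k | i <- h].
  rewrite /in_S; have := perm_map (subn^~ k) Hh.
  rewrite -shift_iota -map_comp => /perm_trans->//.
  by rewrite (eq_map (g := id)) ?map_id // => i /=; rewrite addnK.
exists k; rewrite -map_comp -[LHS]map_id; apply/eq_in_map => i.
by rewrite (perm_mem Hh) mem_iota /=; lia.
Qed.

Lemma hit_perm c (h h' : word) : perm_eq h h' -> is_hit c h -> is_hit c h'.
Proof.
move=> E /hitP[a a0 Hh]; apply/hitP; exists a => //.
by rewrite perm_sym in E; apply: perm_trans Hh.
Qed.

Lemma hit_size c h : is_hit c h -> size h = c.
Proof. by case/hitP=> a _ /perm_size; rewrite size_iota. Qed.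

Lemma hit_convex c h : is_hit c h -> convex h.
Proof. by case/hitP=> a _ /perm_iota_convex. Qed.

(** * The equivalence and an invariant made of cuts *)

Section Equivalence.
Variable c : nat.

Lemma rearrangement_sym u v : rearrangement c u v -> rearrangement c v u.
Proof.
case=> p h h' s hh E; constructor; first exact: hit_perm hh.
by rewrite perm_sym.
Qed.

Lemma S_equiv_sym u v : S_equiv c u v -> S_equiv c v u.
Proof.
elim=> [x y /rearrangement_sym|x|x y z _ xy _ yz]; first exact: rt_step.
  exact: rt_refl.
exact: rt_trans yz xy.
Qed.

Lemma S_equiv_perm u v : S_equiv c u v -> perm_eq u v.
Proof.
elim=> [_ _ [p h h' s _ E]|x|x y z _ xy _ yz] //.
  by rewrite perm_cat2l perm_cat2r.
exact: perm_trans xy yz.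
Qed.

Lemma S_equiv_rev u v : S_equiv c u v -> S_equiv c (rev u) (rev v).
Proof.
elim=> [_ _ [p h h' s hh E]|x|x y z _ xy _ yz].
- apply: rt_step; rewrite !rev_cat -!catA; constructor.
    by apply: hit_perm hh; rewrite perm_sym perm_rev.
  by rewrite perm_rev perm_sym perm_rev perm_sym.
- exact: rt_refl.
- exact: rt_trans xy yz.
Qed.

Lemma S_equiv_small u v : size u < c -> S_equiv c u v -> u = v.
Proof.
move=> uc E; elim: E uc => [_ _ [p h h' s /hit_size hh _]|x|x y z xy IH1 _ IH2] //.
  by rewrite !size_cat; lia.
by move=> xc; rewrite IH1 // IH2 // -(perm_size (S_equiv_perm xy)).
Qed.

(** Position [0] and all positions from [size v] on are cuts vacuously. *)
Definition cut d (v : word) r := allrel (before d) (take r v) (drop r v).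

Lemma before_perm d (u u' v v' : word) : perm_eq u u' -> perm_eq v v' ->
  allrel (before d) u v = allrel (before d) u' v'.
Proof.
move=> /perm_mem U /perm_mem V.
by rewrite (eq_allrel_meml _ _ U) (eq_allrel_memr _ _ V).
Qed.

(* An interior cut [r] of a hit separates it into lower and upper letters, and
   convexity leaves no room between those for a letter outside the hit. *)
Lemma cut_hit d (p h s : word) r :
    uniq (p ++ h ++ s) -> convex h -> size p < r < size p + size h ->
  cut d (p ++ h ++ s) r ->
  allrel (before d) p (h ++ s) /\ allrel (before d) (p ++ h) s.
Proof.
move=> U hh /andP[pr rh].
have [h1 [h2 [Eh s1 s2]]] : exists h1 h2, [/\ h = h1 ++ h2, size p + size h1 = r & h2 != [::]].
  exists (take (r - size p) h), (drop (r - size p) h); rewrite cat_take_drop; split=> //.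
    by rewrite size_takel; lia.
  by rewrite word_neq0 size_drop; lia.
have h1n : h1 != [::] by rewrite word_neq0; lia.
have : p ++ h ++ s = (p ++ h1) ++ (h2 ++ s) by rewrite Eh !catA.
rewrite /cut => ->; rewrite take_size_cat ?drop_size_cat ?size_cat //.
move=> /allrelP K.
have [x1 x1h] : exists x, x \in h1 by case: (h1) h1n => // x l; exists x; rewrite mem_head.
have [x2 x2h] : exists x, x \in h2 by case: (h2) s2 => // x l; exists x; rewrite mem_head.
have Kp x y : x \in p -> y \in h2 ++ s -> before d x y.
  by move=> xp; apply: K; rewrite mem_cat xp.
have Ks x y : x \in p ++ h1 -> y \in s -> before d x y.
  by move=> xp ys; apply: K; rewrite // mem_cat ys orbT.
have mem1 x : x \in h1 -> x \in h by rewrite Eh mem_cat => ->.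
have mem2 x : x \in h2 -> x \in h by rewrite Eh mem_cat => ->; rewrite orbT.
move: U; rewrite !cat_uniq has_cat negb_or -andbA => /and5P[_ ph _ _ /andP[hs _]].
split; apply/allrelP => x y.
  move=> xp; rewrite Eh -catA mem_cat => /orP[yh1|]; last exact: Kp.
  have xh : x \notin h by apply: contra ph => xh; apply/hasP; exists x.
  have ne : x != y by apply: contraNneq xh => ->; exact: mem1.
  case/orP: (before_total d ne) => // yx; case/negP: xh; apply: (hh d y x2) => //; auto.
  by apply: Kp => //; rewrite mem_cat x2h.
rewrite Eh catA mem_cat => /orP[xp ys|xh2 ys]; first exact: Ks.
have yh : y \notin h by apply: contra hs => xh; apply/hasP; exists y.
have ne : x != y by apply: contraNneq yh => <-; exact: mem2.
case/orP: (before_total d ne) => // yx; case/negP: yh; apply: (hh d x1 x) => //; auto.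
by apply: Ks => //; rewrite mem_cat x1h orbT.
Qed.

(** Among the positions [0] to [size v], any [c] successive ones include a cut. Runs have this
    property, rearrangements preserve it, and in words longer than [c] it fixes the order of the
    first and last letters. *)
Definition many_cuts d (v : word) : Prop :=
  forall q, q + c <= (size v).+1 -> exists2 r, q <= r < q + c & cut d v r.

Lemma cut_cat d (a b : word) r :
  size a = r -> cut d (a ++ b) r = allrel (before d) a b.
Proof. by move=> ar; rewrite /cut take_size_cat // drop_size_cat. Qed.

(** Both ends of the rearranged hit are cuts, and they stay cuts, as do all cuts outside the hit.
    Only the [c - 1] interior positions may lose theirs, and a window of [c] positions that meets
    the interior contains an end of the hit. *)
Lemma many_cuts_step d (v v' : word) : 0 < c -> uniq v -> rearrangement c v v' ->
  many_cuts d v -> many_cuts d v'.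
Proof.
move=> c0 U E; case: E U => p h h' s hh E U M.
have sh := hit_size hh; have sh' : size h' = c by rewrite -(perm_size E).
have [Kp Ks] : allrel (before d) p (h ++ s) /\ allrel (before d) (p ++ h) s.
  (* The windows starting at the left end of the hit and one position later give either an interior
     cut, to which [cut_hit] applies, or exactly the two ends. *)
  have [|r1 r1b cut1] := M (size p); first by rewrite !size_cat; lia.
  have [|r2 r2b cut2] := M (size p).+1; first by rewrite !size_cat; lia.
  have [r1p|r1p] := eqVneq r1 (size p); last first.
    by apply: (@cut_hit d p h s r1) => //; [exact: hit_convex hh|rewrite sh; lia].
  have [r2p|r2p] := eqVneq r2 (size (p ++ h)); last first.
    move: r2p; rewrite size_cat => r2p.
    by apply: (@cut_hit d p h s r2) => //; [exact: hit_convex hh|rewrite sh; lia].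
  split; first by rewrite -(cut_cat _ _ (esym r1p)).
  by rewrite -(cut_cat _ _ (esym r2p)) -catA.
move=> q qv; have [|r rb cutr] := M q.
  by move: qv; rewrite !size_cat sh sh'.
move: qv; rewrite !size_cat => qv.
have [rp|rp] := leqP r (size p).
  exists r => //; move: cutr; rewrite -(cat_take_drop r p) -!catA.
  have er : size (take r p) = r by rewrite size_takel.
  rewrite !(cut_cat _ _ er) => K.
  rewrite -(before_perm _ (perm_refl _) (_ : perm_eq (drop r p ++ h ++ s) _)) //.
  by rewrite perm_cat2l perm_cat2r.
have [rc|rc] := leqP (size p + c) r.
  exists r => //; move: cutr.
  have : r <= size (p ++ h ++ s) \/ size (p ++ h ++ s) < r by lia.
  case=> [rs|rs]; last first.
    rewrite /cut !drop_oversize ?allrel0r //; move: rs; rewrite !size_cat ?sh ?sh'; lia.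
  move: rs; rewrite !size_cat ?sh => rs.
  rewrite -(cat_take_drop (r - size p - c) s).
  set s1 := take _ _; set s2 := drop _ _.
  have e1 : size s1 = r - size p - c by rewrite size_takel //; lia.
  have er x : size x = c -> size (p ++ x ++ s1) = r by rewrite !size_cat; lia.
  rewrite !catA -[((p ++ h) ++ s1)]catA -[((p ++ h') ++ s1)]catA.
  rewrite !cut_cat -?catA ?er // => K.
  rewrite -(before_perm _ (_ : perm_eq (p ++ h ++ s1) _) (perm_refl _)) //.
  by rewrite perm_cat2l perm_cat2r.
(* The old cut is interior to the hit, so it is replaced by whichever end of the hit lies in the
   window. *)
have [pq|pq] := leqP q (size p).
  exists (size p); first by lia.
  by rewrite cut_cat // -(before_perm _ (perm_refl _) (_ : perm_eq (h ++ s) _)) // perm_cat2r.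
exists (size (p ++ h')); first by rewrite size_cat sh'; lia.
by rewrite catA cut_cat // -(before_perm _ (_ : perm_eq (p ++ h) _) (perm_refl _)) // perm_cat2l.
Qed.

Lemma many_cuts_equiv d (u v : word) : 0 < c -> S_equiv c u v -> uniq u ->
  many_cuts d u -> many_cuts d v.
Proof.
move=> c0; elim=> {u v} [u v uv Uu|//|u v z uv IH1 _ IH2 Uu Mu].
  exact: many_cuts_step.
by apply: IH2; [rewrite -(perm_uniq (S_equiv_perm uv))|exact: IH1].
Qed.

End Equivalence.

(** * Averages of hits and polarization *)

Section Average.
Local Open Scope ring_scope.

Lemma average_bounds h a c : (0 < c)%N -> perm_eq h (iota a c) ->
  a%:R <= average h <= (a + c).-1%:R.
Proof.
move=> c0 E; have sh : size h = c by rewrite (perm_size E) size_iota.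
have B (l : word) : (forall z, z \in l -> a <= z <= (a + c).-1)%N ->
    (a * size l <= sumn l <= (a + c).-1 * size l)%N.
  elim: l => [|z l IH] H /=; first by rewrite !muln0.
  have := H z (mem_head _ _); have /IH : (forall z, z \in l -> a <= z <= (a + c).-1)%N.
    by move=> t tl; apply: H; rewrite inE tl orbT.
  by rewrite !mulnS; lia.
have /andP[b1 b2] : (a * size h <= sumn h <= (a + c).-1 * size h)%N.
  by apply: B => z; rewrite (perm_mem E) mem_iota; lia.
have c0' : 0 < (size h)%:R :> rat by rewrite ltr0n sh.
by rewrite /average ler_pdivlMr // ler_pdivrMr // -!natrM !ler_nat b1.
Qed.

(** The letters of a hit fill an interval that contains the average, so an outside letter is on the
    same side of the average as of every letter of the hit. This turns rational comparisons into
    comparisons of letters. *)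
Lemma off_average c (h : word) z : (0 < c)%N -> is_hit c h -> z \notin h ->
  (z%:R < average h /\ forall t, t \in h -> (z < t)%N) \/
  (average h < z%:R /\ forall t, t \in h -> (t < z)%N).
Proof.
move=> c0 /hitP[a a0 E] zh; have /andP[b1 b2] := average_bounds c0 E.
move: zh; rewrite (perm_mem E) mem_iota => zh.
have [za|az] := ltnP z a.
  left; split; first by apply: lt_le_trans b1; rewrite ltr_nat.
  by move=> t; rewrite (perm_mem E) mem_iota; lia.
right; split; first by apply: le_lt_trans b2 _; rewrite ltr_nat; lia.
by move=> t; rewrite (perm_mem E) mem_iota; lia.
Qed.

(** If the letter before [h] lies on the other side of [h] than [y], both neighbours yield direction
    [d]. If it lies on the same side, it is beyond [y] by the assumption on [p], hence strictly
    farther away, and [y] decides. *)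
Lemma right_polarized_next c (p h s : word) y d : (1 < c)%N ->
  uniq (p ++ h ++ y :: s) -> is_hit c h ->
  (forall z, z \in h -> before d z y) ->
  (forall z, z \in p -> (forall t, t \in h -> before d t z) ->
     before d z y -> False) ->
  right_polarized p h (y :: s) = d.
Proof.
move=> c1 U hh hy py.
have [a ah] : exists a, a \in h.
  have := hit_size hh; case: (h) => [|a l] sl.
    by move: c1; rewrite -sl.
  by exists a; rewrite mem_head.
have yh : y \notin h by apply/negP => /hy; case: (d); rewrite /before ltnn.
have c0 : (0 < c)%N by lia.
have oy := off_average c0 hh yh.
rewrite /right_polarized; case: (lastP p) U py => [|q x] U py.
  case: oy => -[oy ty]; have := hy _ ah; have := ty _ ah; case: (d);
    rewrite /before; (try lia); move=> _ _ //=.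
  by apply/negbTE; rewrite -leNgt ltW.
rewrite rev_rcons.
have xp : x \in rcons q x by rewrite mem_rcons mem_head.
have xh : x \notin h.
  move: U; rewrite cat_uniq => /and3P[_ /hasPn xx _]; apply/negP => xh.
  by have := xx x; rewrite mem_cat xh xp => /(_ isT).
have xy : x != y.
  move: U; rewrite cat_uniq => /and3P[_ /hasPn xx _]; apply/eqP => xy.
  by have := xx y; rewrite mem_cat mem_head orbT -xy xp => /(_ isT).
have ox := off_average c0 hh xh.
have := py x xp; have := hy a ah; move: (average h) oy ox => A oy ox {py}.
have nD b : (b < A -> `|b - A| = A - b) /\ (A < b -> `|b - A| = b - A).
  by split=> bA; [rewrite ltr0_norm ?opprB // subr_lt0|rewrite gtr0_norm // subr_gt0].
have neR : x%:R != y%:R :> rat by rewrite eqr_nat.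
case: oy => -[oy ty]; case: ox => -[ox tx]; have := ty _ ah; have := tx _ ah;
rewrite ?(proj1 (nD _) ox) ?(proj2 (nD _) ox) ?(proj1 (nD _) oy) ?(proj2 (nD _) oy);
case: d {hy} => /= xa ya ay P; (try lia); try (have := P tx; rewrite -(ltr_nat rat) => PP);
case: ifP => K; rewrite /= ?ox ?oy //; (try (by apply/negbTE; rewrite -leNgt; lra));
by exfalso; case/orP: (lt_total neR) => L; [apply: PP|]; lra.
Qed.
End Average.

Lemma average_perm (h h' : word) : perm_eq h h' -> average h = average h'.
Proof. by move=> E; rewrite /average !sumnE (perm_big _ E) (perm_size E). Qed.

Lemma right_polarized_perm (p h h' s : word) :
  perm_eq h h' -> right_polarized p h s = right_polarized p h' s.
Proof. by move=> E; rewrite /right_polarized (average_perm E). Qed.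

(* Equidistant neighbours of a hit lie on opposite sides of it and then agree
   on its polarization, so reversal is unaffected by the tie-breaking rule. *)
Lemma right_polarized_rev c (p h s : word) :
    0 < c -> uniq (p ++ h ++ s) -> is_hit c h -> p ++ s != [::] ->
  right_polarized (rev s) (rev h) (rev p) = ~~ right_polarized p h s.
Proof.
move=> c0 U hh; rewrite /right_polarized revK (average_perm (_ : perm_eq (rev h) h)) ?perm_rev //.
have off z : z \in p ++ s -> (z%:R < average h \/ average h < z%:R)%R.
  move=> zps; have zh : z \notin h.
    move: U zps; rewrite !cat_uniq has_cat negb_or -andbA mem_cat.
    move=> /and5P[_ /hasPn ph _ _ /andP[/hasPn hs _]] /orP[zp|/hs] //.
    by apply/negP => /ph; rewrite /= zp.
  by case: (off_average c0 hh zh) => -[zA _]; [left|right].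
case: (lastP p) U off => [|q x] U off.
  case: s U off => // y s U off _; case: (off y (mem_head _ _)) => yA; rewrite yA.
    by rewrite -leNgt ltW.
  by apply/negbTE; rewrite -leNgt ltW.
rewrite rev_rcons => _.
have xA := off x; rewrite mem_cat mem_rcons mem_head /= in xA.
case: s U off => [|y s] U off.
  case: xA => // xA; rewrite xA /=.
    by apply/negbTE; rewrite -leNgt ltW.
  by rewrite -leNgt ltW.
have yA := off y; rewrite mem_cat mem_head orbT /= in yA.
have xy : x != y.
  move: U; rewrite cat_uniq => /and3P[_ /hasPn xx _]; apply/eqP => xy.
  by have := xx y; rewrite mem_cat mem_head orbT -xy mem_rcons mem_head => /(_ isT).
move: xA yA => /(_ isT) xA /(_ isT) yA; rewrite -(eqr_nat rat) in xy.
move: (average h) (x%:R%R) (y%:R%R) xA yA xy => A X Y XA YA XY.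
have nD b : ((b < A -> `|b - A| = A - b) /\ (A < b -> `|b - A| = b - A))%R.
  by split=> bA; [rewrite ltr0_norm ?opprB // subr_lt0|rewrite gtr0_norm // subr_gt0].
case: XA => XA; case: YA => YA;
rewrite ?(proj1 (nD _) XA) ?(proj2 (nD _) XA) ?(proj1 (nD _) YA) ?(proj2 (nD _) YA) ?XA ?YA;
rewrite ?(lt_gtF XA) ?(lt_gtF YA); do !case: ifP => //; rewrite ?leNgt;
try (move=> /negbFE K /negbFE L); try (rewrite -!leNgt => K L);
by exfalso; case/orP: (lt_total XY); lra.
Qed.

(** The mirror image of [right_polarized_next]: reversing the word negates both the direction and
    the polarization. *)
Lemma right_polarized_prev c (p h s : word) x d : 1 < c ->
  uniq (rcons p x ++ h ++ s) -> is_hit c h ->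
  (forall z, z \in h -> before d x z) ->
  (forall z, z \in s -> (forall t, t \in h -> before d z t) ->
     before d x z -> False) ->
  right_polarized (rcons p x) h s = d.
Proof.
move=> c1 U hh hx sx; apply: negb_inj.
rewrite -(@right_polarized_rev c) //; try lia; last by rewrite word_neq0 size_cat size_rcons.
rewrite rev_rcons; apply: right_polarized_next c1 _ _ _ _.
- by rewrite -rev_rcons -!rev_cat rev_uniq -catA.
- by apply: hit_perm hh; rewrite perm_sym perm_rev.
- by move=> z; rewrite mem_rev before_negb; apply: hx.
- move=> z; rewrite mem_rev before_negb => zs zt; apply: sx => // t th.
  by have := zt t; rewrite mem_rev before_negb; apply.
Qed.

(** * Leaning of runs and the hits of a root permutation *)

Lemma tail_size_run d a c : 1 < c -> (tail_size (run d a c) < c) = d.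
Proof.
move=> c1; rewrite /tail_size size_run.
have -> : sort leq (run d a c) = iota a c.
  apply: (sorted_eq leq_trans anti_leq).
  - exact: sort_sorted leq_total _.
  - exact: iota_sorted.
  - by rewrite perm_sort perm_run.
case: d.
  by rewrite /run; case: (c) c1 => // m m1; rewrite [iota 1 _]/= [find _ _]/= perm_refl.
(* A proper prefix of a decreasing run contains the largest letter [(a + c).-1], so it never
   consists of the smallest letters. *)
set f := find _ _; apply/negbTE; rewrite -leqNgt.
case: (leqP c f.+1) => // fc; exfalso.
have hs : has (fun k => perm_eq (take k (run false a c)) (take k (iota a c))) (iota 1 c).
  by rewrite has_find size_iota; rewrite -/f; lia.
have := nth_find 0 hs; rewrite -/f nth_iota; last by lia.
move/perm_mem/(_ (a + c).-1); rewrite take_iota mem_iota.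
have -> : ((a + c).-1 \in take (1 + f) (run false a c)) = true.
  case: (c) c1 => // m _; rewrite /run -addn1 iotaD rev_cat /= inE.
  by rewrite addn1 addnS eqxx.
lia.
Qed.

(** An increasing run leans right only and a decreasing one left only. Hence no run is omni leaning,
    and being backward means disagreeing with the polarization. *)
Lemma backward_run d p s a c : 1 < c ->
  backward p (run d a c) s = (right_polarized p (run d a c) s != d).
Proof.
move=> c1; rewrite /backward /omni_leaning /left_polarized /left_leaning.
rewrite /right_leaning rev_run size_run !tail_size_run //.
by case: d; case: (right_polarized _ _ _).
Qed.

Lemma straightened_run c p h s : 1 < c -> straightened c p h s ->
  exists a, h = run (right_polarized p h s) a c.
Proof.
move=> c1 [fh fb].
have [d [a a0 Eh]] : exists d, exists2 a, 0 < a & h = run d a c.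
  by case: fh => fh; [exists true|exists false]; apply/forms_run.
exists a; case: fb => [|[_ []]].
  by rewrite /forward Eh backward_run // negbK => /eqP->.
(* A backward run always has a forward rearrangement, namely the run in the direction of the
   polarization, which depends only on the set of letters of the hit. *)
exists (run (right_polarized p h s) a c).
  by rewrite Eh perm_sym (perm_trans (perm_run _ _ _)) // perm_sym perm_run.
rewrite /forward backward_run // negbK.
rewrite -(@right_polarized_perm p h) // Eh.
by rewrite perm_sym (perm_trans (perm_run _ _ _)) // perm_sym perm_run.
Qed.

Lemma run_straightened c p h s a : 1 < c -> 0 < a -> perm_eq h (iota a c) ->
  straightened c p (run (right_polarized p h s) a c) s.
Proof.
move=> c1 a0 E; split.
  case: (right_polarized _ _ _); [left|right].
    by apply: (proj2 (forms_run c _ true)); exists a.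
  by apply: (proj2 (forms_run c _ false)); exists a.
left; rewrite /forward backward_run // negbK.
rewrite -(@right_polarized_perm p h) // perm_sym.
by apply: perm_trans (perm_run _ _ _) _; rewrite perm_sym.
Qed.

(** Otherwise straightening [h] would lead from [w] to a different word, which would also be
    reachable from the whole class by way of [w], against uniqueness of the root. *)
Lemma root_hit c x w p h s : 1 < c -> is_root c x w -> w = p ++ h ++ s ->
  is_hit c h -> exists a, h = run (right_polarized p h s) a c.
Proof.
move=> c1 [[xw wr] wu] Ew hh; have /hitP[a a0 E] := hh.
exists a; apply/eqP; apply/negPn/negP => /eqP ne.
set h' := run _ a c in ne.
have S : straightening c (p ++ h ++ s) (p ++ h' ++ s).
  constructor=> //; last exact: run_straightened.
    move=> /(straightened_run c1)[b Eb]; apply: ne; rewrite /h' {1}Eb; congr run.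
    (* Both runs have the letters of [h], so their least letters [a] and [b] agree. *)
    have H z : z \in h -> a <= z < a + c by rewrite (perm_mem E) mem_iota.
    have K z : z \in h = (b <= z < b + c) by rewrite {1}Eb mem_run.
    have := H b; have := K a; rewrite (perm_mem E) K mem_iota; lia.
  by apply: perm_trans E _; rewrite perm_sym perm_run.
have : w = p ++ h' ++ s.
  apply: wu; split.
    apply: rt_trans xw _; rewrite Ew; apply: rt_step.
    constructor=> //; apply: perm_trans E _; rewrite perm_sym; exact: perm_run.
  by move=> u /wr uw; apply: rt_trans uw _; rewrite Ew; apply: rt_step.
rewrite Ew => /(congr1 (drop (size p))); rewrite !drop_size_cat // => /(congr1 (take c)).
by rewrite !take_size_cat ?size_run // (hit_size hh).
Qed.

(* [turned] records, in a form stable under reversal, what polarization says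
   about the orientation of the hits of a root permutation. *)
Record turned (c : nat) (w : word) : Prop := Turned {
  turned_run : forall p h s, w = p ++ h ++ s -> is_hit c h ->
    exists d a, h = run d a c;
  turned_next : forall p h y s d, w = p ++ h ++ y :: s -> is_hit c h ->
    (forall z, z \in h -> before d z y) ->
    (forall z, z \in p -> (forall t, t \in h -> before d t z) ->
       before d z y -> False) ->
    exists a, h = run d a c;
  turned_prev : forall p h x s d, w = rcons p x ++ h ++ s -> is_hit c h ->
    (forall z, z \in h -> before d x z) ->
    (forall z, z \in s -> (forall t, t \in h -> before d z t) ->
       before d x z -> False) ->
    exists a, h = run d a c }.

Lemma root_turned c x w : 1 < c -> uniq w -> is_root c x w -> turned c w.
Proof.
move=> c1 U R; split.
- by move=> p h s Ew hh; have [a Eh] := root_hit c1 R Ew hh; eexists; exists a; exact: Eh.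
- move=> p h y s d Ew hh H K; have [a Eh] := root_hit c1 R Ew hh; exists a.
  rewrite {1}Eh; congr run; apply: (right_polarized_next c1) => //; by rewrite -Ew.
- move=> p h y s d Ew hh H K; have [a Eh] := root_hit c1 R Ew hh; exists a.
  rewrite {1}Eh; congr run; apply: (right_polarized_prev c1) => //; by rewrite -Ew.
Qed.

(** Reversal exchanges [turned_next] with [turned_prev] and negates the direction. *)
Lemma turned_rev c w : turned c w -> turned c (rev w).
Proof.
have E w' p h s : rev w' = p ++ h ++ s -> w' = rev s ++ rev h ++ rev p.
  by move=> E; rewrite -[w']revK E !rev_cat catA.
have hr h : is_hit c h -> is_hit c (rev h).
  by apply: hit_perm; rewrite perm_sym perm_rev.
have R d a h : rev h = run d a c -> h = run (~~ d) a c.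
  by move=> Eh; rewrite -[h]revK Eh rev_run.
case=> T1 T2 T3; split.
- move=> p h s /E Ew /hr hh; have [d [a /R ->]] := T1 _ _ _ Ew hh.
  by exists (~~ d), a.
- move=> p h y s d /E Ew /hr hh H K; rewrite rev_cons in Ew.
  case: (T3 _ _ _ _ (~~ d) Ew hh) => [z|z|a /R ->]; last by exists a; rewrite negbK.
    by rewrite mem_rev before_negb; apply: H.
  rewrite mem_rev before_negb => zp zt; apply: K => // t th.
  by have := zt t; rewrite mem_rev before_negb; apply.
- move=> p h y s d /E Ew /hr hh H K; rewrite rev_rcons in Ew.
  case: (T2 _ _ _ _ (~~ d) Ew hh) => [z|z|a /R ->]; last by exists a; rewrite negbK.
    by rewrite mem_rev before_negb; apply: H.
  rewrite mem_rev before_negb => zp zt; apply: K => // t th.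
  by have := zt t; rewrite mem_rev before_negb; apply.
Qed.

(** * Orientation of rearranged blocks and the letters of their end parts *)

Lemma sorted_before_cat d (a b : word) :
  sorted (before d) (a ++ b) -> allrel (before d) a b.
Proof. by rewrite (sorted_pairwise (@before_trans d)) pairwise_cat => /and3P[]. Qed.

Lemma many_cuts_run c d a m : 0 < c -> many_cuts c d (run d a m).
Proof.
move=> c0 q _; exists q; first by lia.
by apply: sorted_before_cat; rewrite cat_take_drop run_sorted.
Qed.

(** As [c < m], the positions [1] to [c] are all interior. One of them is a cut, and it separates
    the first letter from the last. *)
Lemma equiv_run_head_last c d a m v : 0 < c -> c < m ->
  S_equiv c (run d a m) v -> before d (head 0 v) (last 0 v).
Proof.
move=> c0 cm E; have := many_cuts_equiv c0 E _ (@many_cuts_run c d a m c0).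
rewrite (perm_uniq (perm_run d a m)) iota_uniq => /(_ isT)/(_ 1).
have sv : size v = m by rewrite -(perm_size (S_equiv_perm E)) size_run.
rewrite sv => -[|r rb /allrelP K]; first by lia.
apply: K.
  case: (v) sv => [/= sm|x l _]; first by rewrite -sm in cm.
  by case: (r) rb => // r' _; rewrite /= mem_head.
rewrite -[in last 0 v](cat_take_drop r v) last_cat.
have : 0 < size (drop r v) by rewrite size_drop sv; lia.
by case: (drop r v) => // x l _; exact: mem_last.
Qed.

Lemma uniq_cat_disjoint (a b : word) z : uniq (a ++ b) -> z \in a -> z \in b -> False.
Proof. by rewrite cat_uniq => /and3P[_ /hasPn ab _] za /ab; rewrite /= za. Qed.

(** Both [t] and [t'] consist of the same number of topmost letters, in direction [d], of one
    set. *)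
Lemma upper_perm d (b t b' t' : word) :
    perm_eq (b ++ t) (b' ++ t') -> uniq (b ++ t) -> size t = size t' ->
    allrel (before d) b t -> allrel (before d) b' t' ->
  perm_eq t t'.
Proof.
move=> E U st /allrelP K /allrelP K'.
have U' : uniq (b' ++ t') by rewrite -(perm_uniq E).
have Ut : uniq t by move: U; rewrite cat_uniq => /and3P[].
have Ut' : uniq t' by move: U'; rewrite cat_uniq => /and3P[].
have S : {subset t <= t'}.
  move=> z zt; apply/negPn/negP => zt'.
  have zb' : z \in b'.
    by have := perm_mem E z; rewrite !mem_cat zt orbT (negbTE zt') orbF => <-.
  (* A letter of [t'] outside [t] would be in [b], hence before [z], while [z] in [b'] is before
     it. *)
  have S' : {subset t' <= t}.
    move=> g gt'; have := perm_mem E g; rewrite !mem_cat gt' orbT => /orP[gb|//].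
    by case: (before_asym (K g z gb zt) (K' z g zb' gt')).
  have [_ /(_ z)] := uniq_min_size Ut' S' (eq_leq st).
  by rewrite zt (negbTE zt').
apply: uniq_perm => //.
by have [] := uniq_min_size Ut S (eq_leq (esym st)).
Qed.

(* If the block [v] is cut by the hit [t ++ R], then [v] has to be oriented
   towards the letters of [R]: for blocks longer than [c] the orientation
   survives all rearrangements, while a block of length [c] is itself a hit,
   whose closest neighbour is the letter following it. *)
Lemma suffix_perm c P v nb N b t R r d e m :
    1 < c -> uniq (P ++ v ++ nb ++ N) -> turned c (P ++ v ++ nb ++ N) ->
    v = run d e m -> 0 < e -> convex nb -> S_equiv c v (b ++ t) -> t != [::] ->
    is_hit c (t ++ R) -> {subset R <= nb ++ N} -> r \in R -> r \in nb ->
  perm_eq t (drop (size b) v).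
Proof.
move=> c1 U T Ev e0 cnb E tn hh RN rR rnb.
have [vc|cv] := ltnP (size v) c.
  by rewrite (S_equiv_small vc E) drop_size_cat.
have Pv := S_equiv_perm E.
have cv' : convex v by rewrite Ev; apply: run_convex.
have ch := hit_convex hh.
have UP z : z \in P -> z \in v ++ nb ++ N -> False := uniq_cat_disjoint U.
have Uv z : z \in v -> z \in nb ++ N -> False.
  by apply: uniq_cat_disjoint; move: U; rewrite cat_uniq => /and3P[].
have Unb z : z \in nb -> z \in nb ++ N by rewrite mem_cat => ->.
have Ubt : uniq (b ++ t).
  rewrite -(perm_uniq Pv); move: U; rewrite cat_uniq => /and3P[_ _].
  by rewrite cat_uniq => /and3P[].
have bv z : z \in b -> z \in v by rewrite (perm_mem Pv) mem_cat => ->.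
have tv z : z \in t -> z \in v by rewrite (perm_mem Pv) mem_cat => ->; rewrite orbT.
have [t0 t0t] : exists t0, t0 \in t by case: (t) tn => // x l; exists x; rewrite mem_head.
have nvr z : z \in v -> z != r.
  by move=> zv; apply/eqP => zr; apply: (Uv r); [rewrite -zr|exact: Unb].
have [f t0r] : exists f, before f t0 r.
  case/orP: (before_total true (nvr _ (tv _ t0t))) => H; first by exists true.
  by exists false.
(* Since [v] is convex and omits [r], all of [v] is on the side of [r] where [t0] is. *)
have vr z : z \in v -> before f z r.
  move=> zv; case/orP: (before_total f (nvr _ zv)) => // rz.
  by case: (Uv r); [apply: (cv' f t0 z r) => //; exact: tv|exact: Unb].
(* A letter of [b] beyond one of [t] would lie between two letters of the hit, so it would belong to
   the hit. *)
have bt : allrel (before f) b t.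
  apply/allrelP => z g zb gt.
  have ne : z != g.
    by apply/eqP => zg; apply: (uniq_cat_disjoint Ubt zb); rewrite zg.
  case/orP: (before_total f ne) => // gz.
  have : z \in t ++ R.
    apply: (ch f g r) => //; rewrite ?mem_cat ?gt ?rR ?orbT //.
    by apply: vr; exact: bv.
  rewrite mem_cat => /orP[zt|/RN zN]; first by case: (uniq_cat_disjoint Ubt zb zt).
  by case: (Uv z (bv _ zb) zN).
have st : size v = size b + size t by rewrite (perm_size Pv) size_cat.
have df : d = f.
  have [mc|cm] := leqP m c.
    have Em : m = c by apply/eqP; rewrite eqn_leq mc; move: cv; rewrite Ev size_run.
    case: nb {Unb} cnb U T RN rnb UP Uv => // y nb cnb U T RN rnb UP Uv.
    have hv : is_hit c v by apply/hitP; exists e; rewrite // Ev Em perm_run.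
    (* The letter [y] after [v] is on the side of [r] because [nb] is convex. No letter of [P] lies
       between [v] and [y]: before [r] it would belong to the hit, beyond [r] to [nb]. *)
    have [||a Ea] := turned_next (d := f) T (erefl _) hv.
    - move=> z zv; have ne : z != y.
        by apply/eqP => zy; apply: (Uv z zv); rewrite zy mem_cat mem_head.
      case/orP: (before_total f ne) => // yz; case: (Uv z zv).
      rewrite mem_cat; apply/orP; left.
      by apply: (cnb f y r) => //; [exact: mem_head|exact: vr].
    - move=> z zP zv zy.
      have t0z := zv _ (tv _ t0t).
      have nzr : z != r.
        apply/eqP => zr; apply: (UP z zP); rewrite mem_cat zr.
        by rewrite [in X in _ || X]mem_cat rnb orbT.
      case/orP: (before_total f nzr) => H.
        have : z \in t ++ R by apply: (ch f t0 r); rewrite ?mem_cat ?t0t ?rR ?orbT.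
        rewrite mem_cat => /orP[/tv zt|/RN zN]; apply: (UP z zP).
          by rewrite mem_cat zt.
        by rewrite mem_cat zN orbT.
      apply: (UP z zP); rewrite mem_cat mem_cat.
      by rewrite (cnb f r y z) ?orbT // mem_head.
    by apply: (@run_inj d f e a c) => //; rewrite -Ea Ev Em.
  have c0 : 0 < c by lia.
  have H : S_equiv c (run d e m) (b ++ t) by rewrite -Ev.
  have := equiv_run_head_last c0 cm H.
  (* The hit has only [c] letters and the block more, so [t] cannot be the whole block. *)
  have sb : 0 < size b.
    have := hit_size hh; rewrite size_cat; move: st; rewrite Ev size_run; lia.
  case: (b) sb bt => // x l _ /allrelP bt H'; apply: before_inj H' _; apply: bt.
    by rewrite mem_head.
  rewrite last_cat; case: (t) tn => // z t' _; exact: mem_last.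
apply: (@upper_perm f b _ (take (size b) v)) => //.
- by rewrite cat_take_drop perm_sym.
- by rewrite size_drop st; lia.
- apply: sorted_before_cat; rewrite cat_take_drop Ev df; exact: run_sorted.
Qed.

(** The mirror image of [suffix_perm], obtained by reversing the whole word. *)
Lemma prefix_perm c P pb v N b t R r d e m :
    1 < c -> uniq (P ++ pb ++ v ++ N) -> turned c (P ++ pb ++ v ++ N) ->
    v = run d e m -> 0 < e -> convex pb -> S_equiv c v (t ++ b) -> t != [::] ->
    is_hit c (R ++ t) -> {subset R <= P ++ pb} -> r \in R -> r \in pb ->
  perm_eq t (take (size t) v).
Proof.
move=> c1 U T Ev e0 cpb E tn hh RP rR rpb.
have st : size v = size t + size b by rewrite (perm_size (S_equiv_perm E)) size_cat.
have Ew : rev (P ++ pb ++ v ++ N) = rev N ++ rev v ++ rev pb ++ rev P.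
  by rewrite !rev_cat !catA.
have : perm_eq (rev t) (drop (size (rev b)) (rev v)).
  apply: (@suffix_perm c (rev N) (rev v) (rev pb) (rev P) _ _ (rev R) r (~~ d) e m) => //.
  - by rewrite -Ew rev_uniq.
  - by rewrite -Ew; apply: turned_rev.
  - by rewrite Ev rev_run.
  - by move=> f x y z; rewrite !mem_rev; apply: cpb.
  - by rewrite -rev_cat; apply: S_equiv_rev.
  - by rewrite word_neq0 size_rev -word_neq0.
  - by rewrite -rev_cat; apply: hit_perm hh; rewrite perm_sym perm_rev.
  - by move=> z; rewrite mem_rev => /RP; rewrite !mem_cat !mem_rev orbC.
  - by rewrite mem_rev.
  - by rewrite mem_rev.
rewrite drop_rev size_rev st addnK => H.
rewrite -(perm_rev t) in H *; apply: perm_trans H _; exact/permEl/perm_rev.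
Qed.

(** * Locating a factor in a concatenation of blocks *)

Lemma cat_eq_split (a b s t : word) : a ++ s = b ++ t -> size a <= size b ->
  exists2 b', b = a ++ b' & s = b' ++ t.
Proof.
move=> E ab; exists (drop (size a) b).
  rewrite -[LHS](cat_take_drop (size a)); congr (_ ++ _).
  by rewrite -(takel_cat t ab) -E take_size_cat.
have : drop (size a) (a ++ s) = s by rewrite drop_size_cat.
rewrite E drop_cat; case: ltnP => [//|ba] <-.
have -> : size a = size b by apply/eqP; rewrite eqn_leq ab.
by rewrite subnn drop0 drop_size.
Qed.

Lemma flatten_split_prefix (vs : seq word) (h s : word) :
    h != [::] -> flatten vs = h ++ s ->
  exists M t b B, [/\ vs = M ++ (t ++ b) :: B, h = flatten M ++ t & t != [::]].
Proof.
elim: vs h => [|v vs IH] h hn /=; first by case: h hn.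
move=> E; have [hv|vh] := leqP (size h) (size v).
  have [b Ev _] := cat_eq_split (esym E) hv.
  by exists [::], h, b, vs; rewrite Ev.
have [h' Eh Es] := cat_eq_split E (ltnW vh).
have hn' : h' != [::].
  by apply: contraTneq vh => h0; rewrite Eh h0 cats0 ltnn.
have [M [t [b [B [-> Eh' tn]]]]] := IH h' hn' Es.
by exists (v :: M), t, b, B; split=> //=; rewrite Eh Eh' catA.
Qed.

(** The outer blocks are those containing the first and the last letter of [h], which is why [t1]
    and [t2] are nonempty. *)
Lemma flatten_split (vs : seq word) (p h s : word) :
    h != [::] -> flatten vs = p ++ h ++ s ->
  (exists A b t B, [/\ vs = A ++ (b ++ h ++ t) :: B, p = flatten A ++ b
                     & s = t ++ flatten B]) \/
  (exists A b1 t1 M t2 b2 B, [/\ vs = A ++ (b1 ++ t1) :: M ++ (t2 ++ b2) :: B,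
      t1 != [::], t2 != [::] & h = t1 ++ flatten M ++ t2]).
Proof.
move=> hn; elim: vs p => [|v vs IH] p /=; first by case: p; case: h hn.
move=> E; have [vp|pv] := leqP (size v) (size p).
  have [p' Ep /IH] := cat_eq_split E vp.
  case=> [[A [b [t [B [-> Ep' ->]]]]]|].
    by left; exists (v :: A), b, t, B; split=> //=; rewrite Ep Ep' catA.
  move=> [A [b1 [t1 [M [t2 [b2 [B [-> tn1 tn2 Eh]]]]]]]]; right.
  by exists (v :: A), b1, t1, M, t2, b2, B.
have [v1 Ev E1] := cat_eq_split (esym E) (ltnW pv).
have v1n : v1 != [::].
  by apply: contraTneq pv => v10; rewrite Ev v10 cats0 ltnn.
have [hv|vh] := leqP (size h) (size v1).
  have [t Et ->] := cat_eq_split E1 hv.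
  by left; exists [::], p, t, vs; rewrite Ev Et.
have [h' Eh Es] := cat_eq_split (esym E1) (ltnW vh).
have hn' : h' != [::].
  by apply: contraTneq vh => h0; rewrite Eh h0 cats0 ltnn.
have [M [t [b [B [-> Eh' tn]]]]] := flatten_split_prefix hn' Es.
by right; exists [::], p, v1, M, t, b, B; split=> //=; rewrite ?Ev // Eh Eh'.
Qed.

(** * Maximal runs, and hits across their boundaries *)

Definition breaks (u v : word) : bool := ~~ adjacent (last 0 u) (head 0 v).

(** A new letter [z] adjacent in value to the head of the first run always extends that run: its
    value on the wrong side is already taken by the second letter, and a run of one letter extends
    either way. *)
Lemma run_decomposition (w : word) : uniq w -> exists vs,
  [/\ w = flatten vs, forall v, v \in vs -> consecutive_run v & sorted breaks vs].
Proof.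
elim: w => [|z w IH] /=; first by exists [::].
case/andP=> zw /IH[[|v vs] [Ew runs br]].
  exists [:: [:: z]]; split=> //=; first by rewrite Ew.
  by move=> u; rewrite inE => /eqP->; exists z, 0; left.
have [zv|zv] := boolP (adjacent z (head 0 v)); last first.
  exists ([:: z] :: v :: vs); split=> /=; first by rewrite Ew.
    by move=> u; rewrite inE => /orP[/eqP->|/runs//]; exists z, 0; left.
  by rewrite {1}/breaks zv.
exists ((z :: v) :: vs); split=> /=; first by rewrite Ew.
  move=> u; rewrite inE => /orP[/eqP->|uvs]; last by apply: runs; rewrite inE uvs orbT.
  have znv : z \notin v by apply: contra zw; rewrite Ew /= mem_cat => ->.
  have [a [m [Ev|Ev]]] := runs v (mem_head _ _).
    move: zv; rewrite Ev /= => /orP[/eqP za|/eqP az].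
      case: m Ev => [|m] Ev.
        by exists a, 1; right; rewrite za.
      by move: znv; rewrite Ev za /= !inE eqxx orbT.
    by exists z, m.+1; left; rewrite az.
  have hv : head 0 v = a + m by rewrite Ev -addn1 iotaD rev_cat.
  move: zv; rewrite hv => /orP[/eqP za|/eqP az].
    exists a, m.+1; right; rewrite Ev -[m.+2]addn1 iotaD rev_cat /= za.
    by rewrite addnS.
  case: m Ev hv az => [|m] Ev hv az.
    by exists z, 1; left; rewrite Ev /= -az addn0.
  by move: znv; rewrite Ev mem_rev mem_iota; lia.
(* Runs are nonempty, so putting [z] in front of [v] does not change the last letter. *)
move: br; case: (vs) => //= v2 vs'; rewrite /breaks; case: (v) runs => //.
by move=> /(_ [::] (mem_head _ _))[a [m [|/(congr1 size)]]] //; rewrite size_rev.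
Qed.

Lemma Forall2_S_equiv_flatten c vs vs' :
  List.Forall2 (S_equiv c) vs vs' -> perm_eq (flatten vs) (flatten vs').
Proof.
by elim=> //= v v' l l' /S_equiv_perm E _ IH; apply: perm_cat.
Qed.

Lemma Forall2_consr T (R : T -> T -> Prop) l y l' : List.Forall2 R l (y :: l') ->
  exists x k, [/\ l = x :: k, R x y & List.Forall2 R k l'].
Proof. by move=> H; inversion H; subst; exists x, l0. Qed.

Lemma sorted_cat_link (e : rel nat) (a b : word) :
  a != [::] -> b != [::] -> sorted e (a ++ b) -> e (last 0 a) (head 0 b).
Proof. by case: a b => [|x a] [|y b] //= _ _; rewrite cat_path /= => /and3P[]. Qed.

Lemma no_crossing_hit c vs A b1 t1 M t2 b2 B :
    1 < c -> uniq (flatten vs) -> 0 \notin flatten vs -> turned c (flatten vs) ->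
    (forall v, v \in vs -> consecutive_run v) -> sorted breaks vs ->
    List.Forall2 (S_equiv c) vs (A ++ (b1 ++ t1) :: M ++ (t2 ++ b2) :: B) ->
    t1 != [::] -> t2 != [::] -> ~ is_hit c (t1 ++ flatten M ++ t2).
Proof.
move=> c1 U Z T runs br F tn1 tn2 hh.
have [A0 [X [_ [FX EX]]]] := List.Forall2_app_inv_r _ _ F.
have [v1 [X' [EX' E1 {}FX]]] := Forall2_consr FX.
have [M0 [Y [FM [FY EY]]]] := List.Forall2_app_inv_r _ _ FX.
have [v2 [B0 [EY' E2 _]]] := Forall2_consr FY.
have {EX EX' EY EY'} Evs : vs = A0 ++ v1 :: M0 ++ v2 :: B0.
  by rewrite EX EX' EY EY'.
rewrite {}Evs in U Z T runs br F *.
(* Hits have positive letters; the absence of [0] makes every run start at a positive letter. *)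
have runP v : v \in A0 ++ v1 :: M0 ++ v2 :: B0 -> exists d e m, v = run d e m.+1 /\ 0 < e.
  move=> vin; have [d [e [m Ev]]] := consecutive_runP (runs v vin).
  exists d, e, m; split=> //; case: e Ev => // Ev; case/negP: Z.
  by apply/flattenP; exists v; rewrite // Ev mem_run.
have [d1 [e1 [m1 [Ev1 e1p]]]] : exists d e m, v1 = run d e m.+1 /\ 0 < e.
  by apply: runP; rewrite mem_cat mem_head orbT.
have [d2 [e2 [m2 [Ev2 e2p]]]] : exists d e m, v2 = run d e m.+1 /\ 0 < e.
  by apply: runP; rewrite mem_cat inE mem_cat mem_head !orbT.
have PM := Forall2_S_equiv_flatten FM.
have t2v z : z \in t2 -> z \in v2.
  by rewrite (perm_mem (S_equiv_perm E2)) mem_cat => ->.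
have t1v z : z \in t1 -> z \in v1.
  by rewrite (perm_mem (S_equiv_perm E1)) mem_cat => ->; rewrite orbT.
have neq0 (t : word) : t != [::] -> exists r, r \in t.
  by case: t => // x l; exists x; rewrite mem_head.
have [r1 r1t] := neq0 _ tn1; have [r2 r2t] := neq0 _ tn2.
have mr d e m : e \in run d e m.+1 by rewrite mem_run; lia.
have p1 : perm_eq t1 (drop (size b1) v1).
  move: U T; rewrite flatten_cat /= flatten_cat /=.
  (* The block after [v1] is [v2] or the first block of [M0]. The letter of the hit in it is [r2] in
     the former case and the least letter [e] of [nb] in the latter. *)
  case EM: M0 => [|nb M1] /= U T.
    apply: (@suffix_perm c _ _ v2 (flatten B0) b1 t1 (flatten M ++ t2) r2 d1 e1 m1.+1 c1 U T) => //.
    - by rewrite Ev2; apply: run_convex.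
    - by move=> z; rewrite !mem_cat -(perm_mem PM) EM /= => /t2v->.
    - by rewrite mem_cat r2t orbT.
    - exact: t2v.
  rewrite -catA in U T.
  have [d [e [m [Enb _]]]] : exists d e m, nb = run d e m.+1 /\ 0 < e.
    by apply: runP; rewrite EM mem_cat inE mem_cat mem_head !orbT.
  apply: (@suffix_perm c _ _ nb _ b1 t1 (flatten M ++ t2) e d1 e1 m1.+1 c1 U T) => //.
  - by rewrite Enb; apply: run_convex.
  - move=> z; rewrite !mem_cat -(perm_mem PM) EM /= !mem_cat.
    by case/orP=> [/orP[->//|->]|/t2v->]; rewrite !orbT.
  - by rewrite mem_cat -(perm_mem PM) EM /= mem_cat Enb mr.
  - by rewrite Enb mr.
have p2 : perm_eq t2 (take (size t2) v2).
  move: U T; rewrite flatten_cat /= flatten_cat /=.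
  case/lastP EM: M0 => [|M1 pb] /= U T.
    apply: (@prefix_perm c _ v1 v2 (flatten B0) b2 t2 (t1 ++ flatten M) r1 d2 e2 m2.+1 c1 U T) => //.
    - by rewrite Ev1; apply: run_convex.
    - by rewrite -catA.
    - by move=> z; rewrite !mem_cat -(perm_mem PM) EM /= orbF => /t1v->; rewrite orbT.
    - by rewrite mem_cat r1t.
    - exact: t1v.
  rewrite flatten_rcons -catA [v1 ++ _]catA [flatten A0 ++ _]catA in U T.
  have [d [e [m [Enb _]]]] : exists d e m, pb = run d e m.+1 /\ 0 < e.
    by apply: runP; rewrite EM mem_cat inE mem_cat mem_rcons mem_head !orbT.
  apply: (@prefix_perm c _ pb v2 (flatten B0) b2 t2 (t1 ++ flatten M) e d2 e2 m2.+1 c1 U T) => //.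
  - by rewrite Enb; apply: run_convex.
  - by rewrite -catA.
  - move=> z; rewrite !mem_cat -(perm_mem PM) EM flatten_rcons !mem_cat.
    by case/orP=> [/t1v->|/orP[]->]; rewrite !orbT.
  - by rewrite mem_cat -(perm_mem PM) EM flatten_rcons mem_cat Enb mr !orbT.
  - by rewrite Enb mr.
have h0 : is_hit c (drop (size b1) v1 ++ flatten M0 ++ take (size t2) v2).
  apply: hit_perm hh; apply: perm_cat => //; apply: perm_cat => //.
  by rewrite perm_sym.
have Ew : flatten (A0 ++ v1 :: M0 ++ v2 :: B0) =
    (flatten A0 ++ take (size b1) v1) ++
    (drop (size b1) v1 ++ flatten M0 ++ take (size t2) v2) ++
    (drop (size t2) v2 ++ flatten B0).
  rewrite flatten_cat /= flatten_cat /= -{1}(cat_take_drop (size b1) v1).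
  by rewrite -{1}(cat_take_drop (size t2) v2) -!catA.
have [d [a Ed]] := turned_run T Ew h0.
have d1n : drop (size b1) v1 != [::].
  by apply: contraNneq tn1 => E0; rewrite E0 in p1; rewrite (perm_nilP p1).
have d2n : take (size t2) v2 != [::].
  by apply: contraNneq tn2 => E0; rewrite E0 in p2; rewrite (perm_nilP p2).
(* The window of the root is itself a run, so its letters on the two sides of the boundary after
   [v1] are adjacent, contrary to [breaks]. *)
have := run_adjacent d a c; rewrite -Ed => /(sorted_cat_link d1n) K.
have {K} : adjacent (last 0 (drop (size b1) v1)) (head 0 (flatten M0 ++ take (size t2) v2)).
  by apply: K; rewrite word_neq0 size_cat addn_gt0 -!word_neq0 d2n orbT.
have -> : last 0 (drop (size b1) v1) = last 0 v1.
  rewrite -[in RHS](cat_take_drop (size b1) v1) last_cat.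
  by case: (drop _ _) d1n.
have := (cat_sorted2 br).2; case EM: M0 => [|nb M1] /= /andP[/negP bv _].
  have -> : head 0 (take (size t2) v2) = head 0 v2 by case: (v2) d2n; case: (size t2).
  exact: bv.
have [d' [e [m [Enb _]]]] : exists d e m, nb = run d e m.+1 /\ 0 < e.
  by apply: runP; rewrite EM mem_cat inE mem_cat mem_head !orbT.
have nbn : nb != [::] by rewrite word_neq0 Enb size_run.
by case: (nb) nbn bv.
Qed.

(** * Equivalence acts block by block *)

Lemma blockwise_step c vs vs' u :
    1 < c -> uniq (flatten vs) -> 0 \notin flatten vs -> turned c (flatten vs) ->
    (forall v, v \in vs -> consecutive_run v) -> sorted breaks vs ->
    List.Forall2 (S_equiv c) vs vs' -> rearrangement c (flatten vs') u ->
  exists2 vs'', u = flatten vs'' & List.Forall2 (S_equiv c) vs vs''.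
Proof.
move=> c1 U Z T runs br F; move Ex: (flatten vs') => x xu.
case: xu Ex => p h h' s hh E Ex.
have hn : h != [::] by rewrite word_neq0 (hit_size hh); lia.
case: (flatten_split hn Ex); last first.
  move=> [A [b1 [t1 [M [t2 [b2 [B [Evs' tn1 tn2 Eh]]]]]]]].
  rewrite Evs' in F; rewrite Eh in hh.
  by case: (no_crossing_hit c1 U Z T runs br F tn1 tn2 hh).
move=> [A [b [t [B [Evs' -> ->]]]]]; rewrite Evs' in F.
exists (A ++ (b ++ h' ++ t) :: B); first by rewrite flatten_cat /= -!catA.
have [A0 [X [FA [FX ->]]]] := List.Forall2_app_inv_r _ _ F.
have [v [B0 [-> Ev FB]]] := Forall2_consr FX.
apply: List.Forall2_app => //; apply: List.Forall2_cons => //.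
by apply: rt_trans Ev _; apply: rt_step.
Qed.

Lemma S_equiv_blockwise c vs u :
    1 < c -> uniq (flatten vs) -> 0 \notin flatten vs -> turned c (flatten vs) ->
    (forall v, v \in vs -> consecutive_run v) -> sorted breaks vs ->
    S_equiv c (flatten vs) u ->
  exists2 vs', u = flatten vs' & List.Forall2 (S_equiv c) vs vs'.
Proof.
move=> c1 U Z T runs br E.
(* In existential form the blockwise description is an invariant of the word, which each
   rearrangement passes on. *)
have : exists2 vs', flatten vs = flatten vs' & List.Forall2 (S_equiv c) vs vs'.
  exists vs => //; elim: (vs) => [|v l IH]; constructor=> //; exact: rt_refl.
elim: E => [x y xy [vs' Ex F]|//|x y z _ IH1 _ IH2 /IH1/IH2//].
by rewrite Ex in xy; apply: blockwise_step F xy.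
Qed.

Lemma S_equiv1 u v : S_equiv 1 u v -> u = v.
Proof.
elim=> [_ _ [p h h' s hh E]|//|x y z _ -> _ -> //].
by rewrite (perm_small_eq _ E) // -(perm_size E) (hit_size hh).
Qed.

Lemma Forall2_S_equiv_nth c vs vs' : List.Forall2 (S_equiv c) vs vs' ->
  shape vs' = shape vs /\
  forall i, perm_eq (nth [::] vs' i) (nth [::] vs i) /\
    S_equiv c (nth [::] vs' i) (nth [::] vs i).
Proof.
elim=> [|v v' l l' E _ [Es En]].
  by split=> // i; rewrite nth_nil; split=> //; exact: rt_refl.
have P := S_equiv_perm E; split; first by rewrite /= Es (perm_size P).
case=> [|i] /=; last exact: En.
by split; [rewrite perm_sym|exact: S_equiv_sym].
Qed.

Theorem theorem4p4 (c n : nat) (c_gt0 : 0 < c) (c_le_n : c <= n)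
    (x : word) (x_perm : in_S n x) (w : word) (w_root : is_root c x w) :
  exists vs : seq word,
    [/\ w = flatten vs,
        forall v, v \in vs -> consecutive_run v
      & forall u, in_S n u -> S_equiv c u w ->
          exists vs' : seq word,
            [/\ u = flatten vs',
                shape vs' = shape vs
              & forall i, i < size vs ->
                  perm_eq (nth [::] vs' i) (nth [::] vs i) /\
                  S_equiv c (nth [::] vs' i) (nth [::] vs i)]].
Proof.
have [[xw _] _] := w_root.
have Pw : perm_eq w (iota 1 n).
  by apply: perm_trans x_perm; rewrite perm_sym; exact: S_equiv_perm xw.
have Uw : uniq w by rewrite (perm_uniq Pw) iota_uniq.
have Zw : 0 \notin w by rewrite (perm_mem Pw) mem_iota.
have [vs [Ew runs br]] := run_decomposition Uw.
exists vs; split=> // u _ uw.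
(* Hits of length one cannot be changed, so the class is a single word; direction is meaningful only
   for longer hits. *)
have [c1|c1] := leqP c 1.
  have Ec : c = 1 by lia.
  rewrite Ec in uw *; exists vs; split=> //; first by rewrite (S_equiv1 uw).
  by move=> i _; split=> //; exact: rt_refl.
have T := root_turned c1 Uw w_root; rewrite Ew in Uw Zw T uw.
have [vs' Eu F] := S_equiv_blockwise c1 Uw Zw T runs br (S_equiv_sym uw).
have [Es En] := Forall2_S_equiv_nth F.
by exists vs'; split=> // i _; exact: En.
Qed.
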